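(* Let $X\in\mathbb R^{d\times n}$ and consider projection dimension $K=1$. Let $\{\mathbf u^k,\mathbf s^k\}$ be generated by $S$-PAMe with parameters $\tau>0$, $\gamma\in[0,1)$: $$\mathbf s^{k+1}=\operatorname{sgn}(\tau\mathbf s^k+X^\top\mathbf e^k),\quad \mathbf u^{k+1}=\operatorname{PD}(X\mathbf s^{k+1}),\quad \mathbf e^{k+1}=\mathbf u^{k+1}-\gamma(\mathbf u^k-\mathbf u^{k+1}),\quad k=0,1,2,\ldots,$$ where the unit vector $\mathbf u^0$ is chosen such that $\|X^\top\mathbf u^0\|_1\neq0$. Then for $\tau$ and $\gamma$ small enough (i.e. $0<\tau<\bar\tau$ for some $\bar\tau>0$, and $\gamma<\bar\gamma$ for some $\bar\gamma>0$ that may depend on $\tau$), after at most $\left\lceil\frac{4F^{\max}}{\tau(1-\gamma)}\right\rceil$ steps the algorithm stops at a FOC point.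
   Context: $\|\cdot\|$ is the Euclidean norm, $\|\cdot\|_1$ the $L_1$-norm. $\operatorname{sgn}(x)=x/|x|$ if $x\ne0$, $\operatorname{sgn}(0)=0$, applied entrywise. For a vector $C\neq0$, $\operatorname{PD}(C)=C/\|C\|$ (the orthonormal factor of its polar decomposition); for $C=0$, $\operatorname{PD}(C)$ is any unit vector. $F^{\max}:=\max_{\|\mathbf u\|=1}\|X^\top\mathbf u\|_1$. Initialization: $\mathbf u^0\in\mathbb R^d$ a unit vector, $\mathbf s^0\in\{0,\pm1\}^n$, $\mathbf e^0=\mathbf u^0$. ''The algorithm stops'' means that the iterates $\mathbf u^k$ and $\mathbf s^k$ do not change any more. A unit vector $\mathbf u\in\mathbb R^d$ is a FOC point (of $\max_{\|\mathbf u\|=1}\|X^\top\mathbf u\|_1$) if there is $\mathbf s\in\mathbb R^n$ with $s_i=\operatorname{sgn}((X^\top\mathbf u)_i)$ when $(X^\top\mathbf u)_i\neq0$ and $s_i\in[-1,1]$ otherwise, such that $\mathbf u=\operatorname{PD}(X\mathbf s)$, i.e. $\langle X\mathbf s,\mathbf u-\mathbf z\rangle\ge0$ for all unit vectors $\mathbf z$. *)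

(* Defs.v *)
From mathcomp Require Import all_boot all_order all_algebra.
From mathcomp Require Import all_classical all_reals all_analysis.

Set Implicit Arguments.
Unset Strict Implicit.
Unset Printing Implicit Defensive.

Import Order.TTheory GRing.Theory Num.Theory numFieldNormedType.Exports.

Local Open Scope classical_set_scope.
Local Open Scope ring_scope.

Section Defs.
Variable R : realType.

(* The canonical norm `|_| of MathComp-Analysis on matrices is the max norm. *)
Definition l2norm (m : nat) (v : 'cV[R]_m) : R :=
  Num.sqrt (\sum_i v i 0 ^+ 2).

Definition l1norm (m : nat) (v : 'cV[R]_m) : R := \sum_i `|v i 0|.

Definition sgn (m : nat) (v : 'cV[R]_m) : 'cV[R]_m := map_mx Num.sg v.

(* PD(0) is any unit vector, so "u = PD(C)" is a relation: each occurrence of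
   PD(0) may take a different value. *)
Definition is_PD (m : nat) (C u : 'cV[R]_m) : Prop :=
  l2norm u = 1 /\ (C != 0 -> u = (l2norm C)^-1 *: C).

Definition Fmax (d n : nat) (X : 'M[R]_(d, n)) : R :=
  sup [set l1norm (X^T *m u) | u in [set u : 'cV[R]_d | l2norm u = 1]].

Definition FOC_point (d n : nat) (X : 'M[R]_(d, n)) (u : 'cV[R]_d) : Prop :=
  l2norm u = 1 /\
  exists s : 'cV[R]_n,
    [/\ forall i, (X^T *m u) i 0 != 0 -> s i 0 = Num.sg ((X^T *m u) i 0),
        forall i, (X^T *m u) i 0 = 0 -> -1 <= s i 0 <= 1
      & is_PD (X *m s) u].

Definition S_PAMe (d n : nat) (X : 'M[R]_(d, n)) (tau gamma : R)
    (u0 : 'cV[R]_d) (s0 : 'cV[R]_n)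
    (u : nat -> 'cV[R]_d) (s : nat -> 'cV[R]_n) (e : nat -> 'cV[R]_d) : Prop :=
  [/\ u 0%N = u0, s 0%N = s0, e 0%N = u0 &
      forall k, [/\ s k.+1 = sgn (tau *: s k + X^T *m e k),
                    is_PD (X *m s k.+1) (u k.+1)
                  & e k.+1 = u k.+1 - gamma *: (u k - u k.+1)]].

Definition stopped_at (d n : nat) (u : nat -> 'cV[R]_d) (s : nat -> 'cV[R]_n)
    (k : nat) : Prop :=
  forall j, (k <= j)%N -> u j = u k /\ s j = s k.

(* The supremum defining Fmax is attained. *)
Lemma Fmax_max (d n : nat) (X : 'M[R]_(d, n)) : (0 < d)%N ->
  (exists2 u : 'cV[R]_d, l2norm u = 1 & l1norm (X^T *m u) = Fmax X) /\
  (forall u : 'cV[R]_d, l2norm u = 1 -> l1norm (X^T *m u) <= Fmax X).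
Proof.
move=> d_gt0.
pose f (v : 'rV[R]_d) : R := l1norm (X^T *m v^T).
pose g (v : 'rV[R]_d) : R := \sum_i v 0 i ^+ 2.
pose A := [set v : 'rV[R]_d | g v = 1].
have gE (u : 'cV[R]_d) : (l2norm u = 1) <-> A u^T.
  have -> : A u^T = (\sum_i u i 0 ^+ 2 = 1).
    by rewrite /A /g /=; congr (_ = _); apply: eq_bigr => i _; rewrite mxE.
  split=> [u1|s1]; last by rewrite /l2norm s1 sqrtr1.
  have s_ge0 : 0 <= \sum_i u i 0 ^+ 2 by apply: sumr_ge0 => i _; exact: sqr_ge0.
  by rewrite -(sqr_sqrtr s_ge0) -/(l2norm u) u1 expr1n.
have sum_cont (T : topologicalType) m (h : 'I_m -> T -> R) :
    (forall i, continuous (h i)) -> continuous (fun v => \sum_i h i v).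
  move=> hc v; apply: cvg_big => [|i _]; last exact: hc.
  exact: add_continuous.
have g_cont : continuous g.
  apply: (sum_cont _) => i v; apply: continuousM => //; exact: coord_continuous.
have f_cont : continuous f.
  apply: (sum_cont _) => i v.
  apply: (@continuous_comp _ _ _ (fun w : 'rV[R]_d => (X^T *m w^T) i 0) Num.norm).
    have -> : (fun w : 'rV[R]_d => (X^T *m w^T) i 0) =
              (fun w => \sum_j X j i * w 0 j).
      by apply/funext => w; rewrite mxE; apply: eq_bigr => j _; rewrite !mxE.
    apply: (sum_cont _) => j w; apply: continuousM; first exact: cst_continuous.
    exact: coord_continuous.
  exact: norm_continuous.
have A0 : A !=set0.
  exists (delta_mx 0 (Ordinal d_gt0)); rewrite /A /g /=.
  rewrite (bigD1 (Ordinal d_gt0)) //= !mxE !eqxx expr1n big1 ?addr0 // => i.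
  by move=> /negPf ne; rewrite mxE ne andbF expr0n.
have A_compact : compact A.
  apply: bounded_closed_compact.
    exists 1; split=> // M M1 v gv /=.
    rewrite [leLHS]/Num.norm /= mx_normrE; apply: bigmax_le => [|[i j] _ /=].
      by apply: le_trans (ltW M1); exact: ler01.
    apply: le_trans (ltW M1); rewrite ord1 -(@ler_pXn2r _ 2) ?nnegrE //.
    rewrite expr1n real_normK ?num_real // -gv /g (bigD1 j) //= lerDl.
    by apply: sumr_ge0 => k _; exact: sqr_ge0.
  have -> : A = g @^-1` [set x | x = 1] by [].
  by apply: closed_comp => [v _|]; [exact: g_cont|exact: closed_eq].
have [c Ac fc] := EVT_max_rV A0 A_compact (continuous_subspaceT f_cont).
have c1 : l2norm c^T = 1 by apply/gE; rewrite trmxK; exact/set_mem.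
have le_c (u : 'cV[R]_d) : l2norm u = 1 -> l1norm (X^T *m u) <= f c.
  by move=> /gE/mem_set/fc; rewrite /f trmxK.
have ub_c : ubound [set l1norm (X^T *m u) | u in [set u | l2norm u = 1]] (f c).
  by move=> _ [u /= u1 <-]; exact: le_c.
have FE : Fmax X = f c.
  apply/eqP; rewrite eq_le; apply/andP; split.
    by apply: ge_sup => //; exists (f c), c^T.
  by apply: ub_le_sup; [exists (f c)|exists c^T].
by split=> [|u u1]; [exists c^T|rewrite FE; exact: le_c].
Qed.

End Defs.

(* Main.v *)
(* The vectors u^k, k >= 1, are among the finitely many PD(X s) with s a sign
   vector, so the nonzero entries of all X^T u^k are at least some delta > 0 in
   absolute value.  Once tau and the extrapolation term are small compared with
   delta, and the latter also compared with tau, the update of s becomes: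
   s^{k+1}_i is the sign of (X^T u^k)_i if this entry is nonzero, and s^k_i
   otherwise.  Then <s^{k+1}, X^T u^k> = ||X^T u^k||_1, whence
   ||X^T u^k||_1 <= <s^{k+1}, X^T u^{k+1}> <= ||X^T u^{k+1}||_1, and the last
   inequality has a gap delta whenever s^{k+2} <> s^{k+1}.  As the objective is
   at least delta initially and at most F^max, s is unchanged after at most
   F^max / delta steps, and then it remains so. *)
Require Import Defs.
From mathcomp Require Import all_boot all_order all_algebra.
From mathcomp Require Import all_classical all_reals all_analysis.
From mathcomp Require Import lra.

Set Implicit Arguments.
Unset Strict Implicit.
Unset Printing Implicit Defensive.

Import Order.TTheory GRing.Theory Num.Theory numFieldNormedType.Exports.

Local Open Scope ring_scope.

(** * Scalar products, the sign update and the variational form of [PD] *)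

Definition dot (R : realType) (m : nat) (x y : 'cV[R]_m) : R := (x^T *m y) 0 0.

(** For [s] with entries 0, 1, -1, this is [sgn (tau *: s + a)] for every sufficiently small
    [tau > 0]. *)
Definition sgn_keep (R : realType) (m : nat) (a s : 'cV[R]_m) : 'cV[R]_m :=
  \col_i (if a i 0 == 0 then s i 0 else Num.sg (a i 0)).

Lemma dotE (R : realType) (m : nat) (x y : 'cV[R]_m) :
  dot x y = \sum_i x i 0 * y i 0.
Proof. by rewrite /dot mxE; apply: eq_bigr => i _; rewrite mxE. Qed.

Lemma dot_mulmx (R : realType) (d n : nat) (X : 'M[R]_(d, n)) s u :
  dot (X *m s) u = dot s (X^T *m u).
Proof. by rewrite /dot trmx_mul mulmxA. Qed.

Lemma dot_le_l1norm (R : realType) (m : nat) (s a : 'cV[R]_m) :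
  (forall i, `|s i 0| <= 1) -> dot s a <= l1norm a.
Proof.
move=> s1; rewrite dotE; apply: ler_sum => i _.
by rewrite (le_trans (ler_norm _))// normrM ler_piMl.
Qed.

Lemma dot_sgn_keep (R : realType) (m : nat) (a s : 'cV[R]_m) :
  dot (sgn_keep a s) a = l1norm a.
Proof.
rewrite dotE; apply: eq_bigr => i _; rewrite mxE.
by case: eqVneq => [->|_]; rewrite ?mulr0 ?normr0// normrEsg.
Qed.

Lemma dot_unit_le1 (R : realType) (m : nat) (u v : 'cV[R]_m) :
  l2norm u = 1 -> l2norm v = 1 -> dot u v <= 1.
Proof.
have sq (w : 'cV[R]_m) : l2norm w = 1 -> \sum_i w i 0 ^+ 2 = 1.
  move=> w1; rewrite -[LHS]sqr_sqrtr -/(l2norm w) ?w1 ?expr1n//.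
  by apply: sumr_ge0 => i _; exact: sqr_ge0.
move=> /sq u1 /sq v1.
have : 0 <= \sum_i (u i 0 - v i 0) ^+ 2.
  by apply: sumr_ge0 => i _; exact: sqr_ge0.
have -> : \sum_i (u i 0 - v i 0) ^+ 2 =
    \sum_i u i 0 ^+ 2 - dot u v *+ 2 + \sum_i v i 0 ^+ 2.
  rewrite dotE -sumrMnl -sumrN -!big_split/=.
  by apply: eq_bigr => i _; rewrite sqrrB.
rewrite u1 v1; lra.
Qed.

Lemma is_PD_max (R : realType) (m : nat) (C u v : 'cV[R]_m) :
  is_PD C u -> l2norm v = 1 -> dot C v <= dot C u.
Proof.
move=> [u1 uE] v1; have [->|C0] := eqVneq C 0.
  by rewrite /dot trmx0 !mul0mx.
(* As [0^-1 = 0], a vanishing norm would make [u] zero, against [l2norm u = 1]. *)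
have c0 : l2norm C != 0.
  apply/eqP => c0; move: u1; rewrite (uE C0) c0 invr0 scale0r /l2norm.
  rewrite big1 ?sqrtr0 => [/esym/eqP|i _]; first by rewrite oner_eq0.
  by rewrite mxE expr0n.
have CE : C = l2norm C *: u by rewrite (uE C0) scalerA divff// scale1r.
have dotC w : dot C w = l2norm C * dot u w.
  by rewrite {1}CE /dot linearZ/= -scalemxAl mxE.
rewrite !dotC ler_wpM2l ?sqrtr_ge0//.
rewrite (le_trans (dot_unit_le1 u1 v1))//.
have -> : dot u u = l2norm u ^+ 2.
  rewrite sqr_sqrtr; last by apply: sumr_ge0 => i _; exact: sqr_ge0.
  by rewrite dotE; apply: eq_bigr => i _; rewrite expr2.
by rewrite u1 expr1n.
Qed.

(** * Stability of signs and the gap of the nonzero entries *)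

Lemma sgr_addl_small (R : realDomainType) (x y : R) :
  `|y| < `|x| -> Num.sg (y + x) = Num.sg x.
Proof.
rewrite ltr_norml => /andP[].
case: (ltrgt0P x) => [x0|x0|->]; last by rewrite oppr0 => ? ?; lra.
  by move=> ? ?; rewrite !gtr0_sg//; lra.
by move=> ? ?; rewrite !ltr0_sg//; lra.
Qed.

Lemma seq_nonzero_gap (R : realDomainType) (l : seq R) :
  exists2 delta : R, 0 < delta &
    forall x, x \in l -> x != 0 -> delta <= `|x|.
Proof.
elim: l => [|y l [delta d0 dP]]; first by exists 1.
exists (if y == 0 then delta else Num.min delta `|y|).
  by case: eqVneq => // y0; rewrite lt_min d0 normr_gt0.
move=> x; rewrite inE => /orP[/eqP ->|xl] x0.
  by rewrite (negPf x0) ge_min lexx orbT.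
by case: ifP => _; rewrite ?ge_min dP.
Qed.

(** The condition [X *m sgn a != 0] excludes the free choice of [PD] at 0, which could yield
    infinitely many vectors. As [u0] is arbitrary, its entries are listed separately. *)
Lemma PD_entry_gap (R : realType) (d n : nat) (X : 'M[R]_(d, n))
    (u0 : 'cV[R]_d) :
  exists2 delta : R, 0 < delta &
    (forall i, (X^T *m u0) i 0 != 0 -> delta <= `|(X^T *m u0) i 0|) /\
    (forall (a : 'cV[R]_n) u, X *m sgn a != 0 -> is_PD (X *m sgn a) u ->
       forall i, (X^T *m u) i 0 != 0 -> delta <= `|(X^T *m u) i 0|).
Proof.
(* The values 0, 1, 2 encode the signs -1, 0, 1. *)
pose vec (t : {ffun 'I_n -> 'I_3}) : 'cV[R]_n := \col_i ((t i)%:R - 1).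
pose pd (C : 'cV[R]_d) := (l2norm C)^-1 *: C.
pose l1 := [seq (X^T *m u0) i 0 | i <- enum 'I_n].
pose l2 := [seq (X^T *m pd (X *m vec p.1)) p.2 0 |
             p <- enum {: {ffun 'I_n -> 'I_3} * 'I_n}].
have [delta d0 dP] := seq_nonzero_gap (l1 ++ l2).
exists delta => //; split=> [i|a u C0 [_ /(_ C0) ->] i]; apply: dP.
  rewrite mem_cat; apply/orP; left.
  by apply/mapP; exists i => //; rewrite mem_enum.
pose t := [ffun j => if a j 0 == 0 then 1 else
                     if 0 < a j 0 then 2%:R else 0 : 'I_3].
have -> : sgn a = vec t.
  apply/matrixP => j k; rewrite ord1 !mxE ffunE.
  case: (ltrgt0P (a j 0)) => [a0|a0|->].
  - by rewrite gtr0_sg//; change (1 = 2 - 1 :> R); lra.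
  - by rewrite ltr0_sg//= sub0r.
  by rewrite sgr0 subrr.
rewrite mem_cat; apply/orP; right.
by apply/mapP; exists (t, i) => //; rewrite mem_enum.
Qed.

Lemma norm_sgn_le1 (R : realType) (m : nat) (a : 'cV[R]_m) i :
  `|sgn a i 0| <= 1.
Proof. by rewrite mxE normr_sg lern1; case: (_ != 0). Qed.


Lemma entry_le_l1norm (R : realType) (m : nat) (a : 'cV[R]_m) i :
  `|a i 0| <= l1norm a.
Proof. by rewrite /l1norm (bigD1 i)//= lerDl sumr_ge0. Qed.

Lemma sgn_keep_ascent (R : realType) (d n : nat) (X : 'M[R]_(d, n)) u u' s s' :
  l2norm u = 1 -> s' = sgn_keep (X^T *m u) s -> is_PD (X *m s') u' ->
  l1norm (X^T *m u) <= dot s' (X^T *m u').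
Proof.
move=> u1 s'E PD; rewrite -(dot_sgn_keep (X^T *m u) s) -s'E -!dot_mulmx.
exact: is_PD_max.
Qed.

(* If [s] disagrees with [sgn a] at a nonzero entry of [a], then [dot s a]
   falls short of [l1norm a] by at least that entry, as [s] has integer
   entries. *)
Lemma dot_sgn_keep_gap (R : realType) (m : nat) (a b : 'cV[R]_m) (delta : R) :
  (forall i, a i 0 != 0 -> delta <= `|a i 0|) ->
  sgn_keep a (sgn b) != sgn b -> dot (sgn b) a + delta <= l1norm a.
Proof.
move=> gap neq.
have [i neq_i] : exists i, sgn_keep a (sgn b) i 0 != sgn b i 0.
  apply/existsP; apply: contra_neqT neq => /existsPn eq_i.
  apply/matrixP => i j; rewrite ord1; apply/eqP.
  by have := eq_i i; rewrite negbK.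
rewrite dotE /l1norm (bigD1 i)//= [leRHS](bigD1 i)//=.
rewrite addrAC; apply: lerD; last first.
  apply: ler_sum => j _.
  by rewrite (le_trans (ler_norm _))// normrM ler_piMl// norm_sgn_le1.
move: neq_i; rewrite !mxE.
case: (eqVneq (a i 0) 0) => [->|a0]; first by rewrite eqxx.
move=> neq_i; have := gap i a0; rewrite normrEsg; move: neq_i.
case: (ltrgt0P (a i 0)) a0 => // ai _.
  by rewrite (gtr0_sg ai); case: sgrP => //; lra.
by rewrite (ltr0_sg ai); case: sgrP => //; lra.
Qed.

(** * Elimination of [tau] and [gamma] from the iteration *)

(** If [a = 0], then [tau * sigma] either has absolute value [tau] and dominates [p], or vanishes
    together with [p]. Otherwise [tau * sigma + p] is below [2 * tau <= delta <= |a|] in absolute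
    value. *)
Lemma sgr_proximal (R : realFieldType) (tau delta sigma a p : R) :
  0 < tau -> 2 * tau <= delta -> sigma \in [:: 0; 1; -1] -> `|p| < tau ->
  (a != 0 -> delta <= `|a|) -> (sigma = 0 -> a = 0 -> p = 0) ->
  Num.sg (tau * sigma + (a + p)) = if a == 0 then sigma else Num.sg a.
Proof.
move=> tau0 tau_delta sigmaP p_tau gap p0.
have sigma1 : `|sigma| <= 1.
  by move: sigmaP; rewrite !inE => /or3P[]/eqP->; rewrite ?normrN ?normr0 ?normr1.
have sg_sigma : Num.sg sigma = sigma.
  by move: sigmaP; rewrite !inE => /or3P[]/eqP->; rewrite ?sgrN ?sgr0 ?sgr1.
have [a0|a0] := eqVneq a 0.
  rewrite a0 add0r addrC.
  have [sigma0|sigma0] := eqVneq sigma 0.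
    by rewrite (p0 sigma0 a0) add0r sigma0 mulr0 sgr0.
  rewrite sgr_addl_small ?sgrM ?(gtr0_sg tau0) ?mul1r//.
  suff -> : `|tau * sigma| = tau by [].
  rewrite normrM (gtr0_norm tau0).
  by move: sigmaP sigma0; rewrite !inE => /or3P[]/eqP->;
     rewrite ?eqxx// ?normrN normr1 mulr1.
rewrite addrCA addrC sgr_addl_small//.
rewrite (lt_le_trans _ (gap a0))// (lt_le_trans _ tau_delta)//.
rewrite (le_lt_trans (ler_normD _ _))// mulr_natl mulr2n ler_ltD//.
by rewrite normrM (gtr0_norm tau0) ler_piMr// ltW.
Qed.

(* For small parameters the iteration no longer depends on them: an entry
   [0] of [s k.+1] can only be inherited from an entry [0] of [s k] where
   [X^T *m u k] vanishes too, so that the extrapolation leaves it alone. *)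
Lemma S_PAMe_sgn_keep (R : realType) (d n : nat) (X : 'M[R]_(d, n))
    (tau gamma delta F : R) (u0 : 'cV[R]_d) (s0 : 'cV[R]_n)
    (u : nat -> 'cV[R]_d) (s : nat -> 'cV[R]_n) (e : nat -> 'cV[R]_d) :
  l2norm u0 = 1 -> 0 < l1norm (X^T *m u0) ->
  (forall v, l2norm v = 1 -> l1norm (X^T *m v) <= F) ->
  (forall i, (X^T *m u0) i 0 != 0 -> delta <= `|(X^T *m u0) i 0|) ->
  (forall (a : 'cV[R]_n) v, X *m sgn a != 0 -> is_PD (X *m sgn a) v ->
     forall i, (X^T *m v) i 0 != 0 -> delta <= `|(X^T *m v) i 0|) ->
  0 < tau -> 2 * tau <= delta -> 0 <= gamma -> gamma * (2 * F) < tau ->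
  (forall i, s0 i 0 \in [:: 0; 1; -1]) ->
  S_PAMe X tau gamma u0 s0 u s e ->
  forall k,
    [/\ s k.+1 = sgn_keep (X^T *m u k) (s k), X *m s k.+1 != 0,
        l2norm (u k) = 1
      & forall i, (X^T *m u k) i 0 != 0 -> delta <= `|(X^T *m u k) i 0|].
Proof.
move=> u0_1 f0 leF gap0 gap tau0 tau_delta gamma0 gamma_tau s0P.
move=> [u00 s00 e00 rec].
have u1 k : l2norm (u k) = 1.
  by case: k => [|k]; [rewrite u00|have [_ [] ] := rec k].
have sP k i : s k i 0 \in [:: 0; 1; -1].
  case: k => [|k]; first by rewrite s00.
  have [-> _ _] := rec k; rewrite mxE.
  by case: sgrP; rewrite !inE eqxx ?orbT.
(* Pairing [X *m s k.+1] with [u k] gives the objective at [u k], which is at least its positive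
   initial value. *)
have nzX k : l1norm (X^T *m u0) <= l1norm (X^T *m u k) ->
    s k.+1 = sgn_keep (X^T *m u k) (s k) -> X *m s k.+1 != 0.
  move=> f0k sE; apply/eqP => Xs0; move: f0k.
  rewrite -(dot_sgn_keep (X^T *m u k) (s k)) -sE -dot_mulmx Xs0.
  by rewrite /dot trmx0 mul0mx [in leRHS]mxE leNgt f0.
(* The lower bound on the objective is carried along because it makes [X *m s k.+1] nonzero, which
   the gap for [u k.+1] requires. *)
suff H k : [/\ s k.+1 = sgn_keep (X^T *m u k) (s k),
    l1norm (X^T *m u0) <= l1norm (X^T *m u k)
    & forall i, (X^T *m u k) i 0 != 0 -> delta <= `|(X^T *m u k) i 0|].
  by move=> k; have [sE f0k gapk] := H k; split=> //; exact: nzX.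
elim: k => [|k [IHs IHf IHgap]].
  rewrite u00; split=> //; have [-> _ _] := rec 0%N.
  apply/matrixP => i j; rewrite ord1 e00 [RHS]mxE mxE [in LHS]mxE [in LHS]mxE.
  rewrite -[(X^T *m u0) i 0 in LHS]addr0.
  by apply: (@sgr_proximal _ _ delta); rewrite ?normr0//; exact: gap0.
have [sE PD eE] := rec k.
have gapk i : (X^T *m u k.+1) i 0 != 0 -> delta <= `|(X^T *m u k.+1) i 0|.
  by apply: (gap (tau *: s k + X^T *m e k)); rewrite -sE//; exact: nzX.
split=> //; last first.
  rewrite (le_trans IHf)// (le_trans (sgn_keep_ascent (u1 k) IHs PD))//.
  by apply: dot_le_l1norm => i; rewrite sE norm_sgn_le1.
have [-> _ _] := rec k.+1.
apply/matrixP => i j; rewrite ord1 eE [RHS]mxE mxE [in LHS]mxE [in LHS]mxE.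
have -> : (X^T *m (u k.+1 - gamma *: (u k - u k.+1))) i 0 =
    (X^T *m u k.+1) i 0 + gamma * ((X^T *m u k.+1) i 0 - (X^T *m u k) i 0).
  rewrite mulmxBr -scalemxAr mulmxBr !mxE; lra.
apply: (@sgr_proximal _ _ delta) => //.
- rewrite (le_lt_trans _ gamma_tau)// normrM (ger0_norm gamma0) ler_wpM2l//.
  rewrite (le_trans (ler_normB _ _))// mulr_natl mulr2n.
  by apply: lerD; apply: le_trans (entry_le_l1norm _ _) (leF _ _).
- exact: gapk.
move=> + ai0; rewrite IHs mxE ai0 sub0r.
by case: eqVneq => [->|nz /eqP]; rewrite ?oppr0 ?mulr0// sgr_eq0 (negPf nz).
Qed.

Theorem theorem4p4 (R : realType) (d n : nat) (X : 'M[R]_(d, n))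
    (u0 : 'cV[R]_d) (hu0 : l2norm u0 = 1) (hXu0 : l1norm (X^T *m u0) != 0) :
  exists2 taubar : R, 0 < taubar & forall tau : R, 0 < tau < taubar ->
  exists2 gammabar : R, 0 < gammabar &
  forall gamma : R, 0 <= gamma < 1 -> gamma < gammabar ->
  forall (s0 : 'cV[R]_n) (u : nat -> 'cV[R]_d) (s : nat -> 'cV[R]_n)
         (e : nat -> 'cV[R]_d),
    (forall i, s0 i 0 \in [:: 0; 1; -1]) ->
    S_PAMe X tau gamma u0 s0 u s e ->
  exists k : nat,
    [/\ k%:Z <= Num.ceil (4 * Fmax X / (tau * (1 - gamma))),
        stopped_at u s k
      & FOC_point X (u k)].
Proof.
have f0 : 0 < l1norm (X^T *m u0).
  by rewrite lt0r hXu0/=; apply: sumr_ge0.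
have d_gt0 : (0 < d)%N.
  case: d X u0 hu0 {hXu0 f0} => // X u0.
  by rewrite /l2norm big_ord0 sqrtr0 => /esym/eqP; rewrite oner_eq0.
have [_ leF] := Fmax_max X d_gt0.
have F0 : 0 < Fmax X by exact: lt_le_trans f0 (leF _ hu0).
have [delta delta0 [gap0 gap]] := PD_entry_gap X u0.
(* Then [tau * s k] and the extrapolation, each at most [tau] entrywise, cannot flip an entry of
   size [delta]. *)
exists (delta / 2); first by rewrite divr_gt0.
move=> tau /andP[tau0 tau_delta].
(* The entries of [X^T *m (u k.+1 - u k)] are at most [2 * Fmax X] in absolute value, so the
   extrapolation stays below [tau]. *)
exists (tau / (2 * Fmax X)); first by rewrite divr_gt0// mulr_gt0.
move=> gamma /andP[gamma0 gamma1] gamma_tau s0 u s e s0P S.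
have {tau_delta} tau_delta : 2 * tau <= delta by lra.
have {gamma_tau} gamma_tau : gamma * (2 * Fmax X) < tau.
  by rewrite -ltr_pdivlMr// mulr_gt0.
have H := S_PAMe_sgn_keep hu0 f0 leF gap0 gap tau0 tau_delta gamma0 gamma_tau
  s0P S.
have [u00 _ _ rec] := S.
have grow k : s k.+2 != s k.+1 ->
    l1norm (X^T *m u k) + delta <= l1norm (X^T *m u k.+1).
  have [sE _ u1 _] := H k; have [sE' _ _ gap1] := H k.+1.
  have [sgE PD _] := rec k; rewrite sE' => neq.
  rewrite sgE in neq; apply: le_trans (dot_sgn_keep_gap gap1 neq).
  by rewrite lerD2r -sgE; exact: sgn_keep_ascent sE PD.
(* The initial objective already contributes one [delta]; with [m] increases this makes [m.+1], the
   index at which the iteration is shown to stop. *)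
have grow_iter m : (forall k, (k < m)%N -> s k.+2 != s k.+1) ->
    m.+1%:R * delta <= l1norm (X^T *m u m).
  elim: m => [_|m IH neq].
    rewrite mul1r u00.
    have [i ai0] : exists i, (X^T *m u0) i 0 != 0.
      apply/existsP; apply: contra_neqT hXu0 => /existsPn a0.
      rewrite /l1norm big1// => i _; have := a0 i; rewrite negbK => /eqP->.
      exact: normr0.
    by rewrite (le_trans (gap0 i ai0))// entry_le_l1norm.
  rewrite -natr1 mulrDl mul1r (le_trans _ (grow m _)) ?neq// lerD2r IH// => k km.
  by rewrite neq// ltnW.
have bound m : (forall k, (k < m)%N -> s k.+2 != s k.+1) ->
    m.+1%:R * delta <= Fmax X.
  have [_ _ um1 _] := H m.
  by move=> /grow_iter grown; exact: le_trans grown (leF _ um1).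
have ex : exists m, s m.+2 == s m.+1.
  apply: contrapT => /forallNP neq.
  have := bound (Num.truncn (Fmax X / delta)) _.
  rewrite -ler_pdivlMr// leNgt truncnS_gt => /(_ _)/negP; apply=> // k _.
  exact/negP.
case: (ex_minnP ex) => m /eqP stop min_m.
(* By [H] the update of [s] depends on the current [u] and [s] alone, although [e] also involves the
   previous [u]. As [X *m s m.+1] is nonzero, an unchanged [s] also determines [u]. *)
have stopped : stopped_at u s m.+1.
  move=> j /subnKC <-; elim: (j - _)%N => [|i [IHu IHs]]; first by rewrite addn0.
  rewrite addnS; set l := (m.+1 + i)%N in IHu IHs *.
  have sl : s l.+1 = s m.+1.
    have [-> _ _ _] := H l; rewrite IHu IHs.
    by have [<- _ _ _] := H m.+1.
  split=> //.
  have [_ Xs0 _ _] := H m; have [_ [_ uE] _] := rec m; have [_ [_ uE'] _] := rec l.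
  by rewrite uE' sl// uE.
exists m.+1; split=> //; last first.
  (* The vector [s m.+2] carries the signs of [X^T *m u m.+1], and it equals [s m.+1], from which
     [u m.+1] was computed. *)
  have [sE _ u1 _] := H m.+1; have [sgE _ _] := rec m.+1; have [_ PD _] := rec m.
  split=> //; exists (s m.+2); split.
  - by move=> i nz; rewrite sE mxE (negPf nz).
  - by move=> i _; rewrite -ler_norml sgE norm_sgn_le1.
  by rewrite stop.
rewrite -[leLHS](@intrKceil R); apply: le_ceil.
rewrite -pmulrn ler_pdivlMr ?mulr_gt0 ?subr_gt0//.
have /bound : forall k, (k < m)%N -> s k.+2 != s k.+1.
  by move=> k km; apply/negP => /min_m; rewrite leqNgt km.
(* The bound has slack: [tau * (1 - gamma) <= 2 * tau <= delta], and [m.+1] times [delta] is at most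
   [Fmax X]. *)
move=> boundm; rewrite (@le_trans _ _ (m.+1%:R * delta))//; last by lra.
rewrite ler_wpM2l// (le_trans _ tau_delta)//; nra.
Qed.
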